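(* Let $\mathcal{C}$ be the class of finite default theories $\Delta=\langle D,W\rangle$ where $W$ is a set of literals and $D$ consists of defaults of the form $:l/l$ where $l$ is a literal. For $\Delta=\langle D,W\rangle\in\mathcal{C}$, a strict partial order $\mathcal{P}$ on $D$ and a literal $l$, testing $\Delta\models^L_{\mathcal{P}}l$ can be done in polynomial time in the size of $\Delta$, $\mathcal{P}$ and $l$.
   Context: $\mathcal{L}$ is the set of formulae of classical propositional logic, $\models$ classical logical consequence, and $Cn(S)=\{\phi\in\mathcal{L}\mid S\models\phi\}$ for $S\subseteq\mathcal{L}$. A default is a rule $\alpha{:}\beta_1,\ldots,\beta_n/\gamma$ with $\alpha,\beta_1,\ldots,\beta_n,\gamma\in\mathcal{L}$ (prerequisite $\alpha$, justifications $\beta_j$, conclusion $\gamma$); $:l/l$ denotes $\top{:}l/l$ with $\top$ a valid formula. A default theory is a pair $\langle D,W\rangle$ with $D$ a set of defaults and $W\subseteq\mathcal{L}$. (Reiter) extensions: for $S\subseteq\mathcal{L}$ let $\Gamma(S)$ be the smallest set such that $W\subseteq\Gamma(S)$, $Cn(\Gamma(S))=\Gamma(S)$, and whenever $\alpha{:}\beta_1,\ldots,\beta_n/\gamma\in D$, $\alpha\in\Gamma(S)$ and $\{\neg\beta_1,\ldots,\neg\beta_n\}\cap S=\emptyset$, then $\gamma\in\Gamma(S)$. $E\subseteq\mathcal{L}$ is an extension of $\langle D,W\rangle$ iff $\Gamma(E)=E$. A default $\alpha{:}\beta_1,\ldots,\beta_n/\gamma$ is applied in $E$, written $\mathrm{appl}(\delta,E)$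 for this default $\delta$, if $E\models\alpha$ and $\{\neg\beta_1,\ldots,\neg\beta_n\}\cap Cn(E)=\emptyset$. $\mathrm{appl}(\delta,E,E')$ abbreviates ''$\mathrm{appl}(\delta,E)$ and not $\mathrm{appl}(\delta,E')$''. Let $\mathcal{P}$ be a strict partial order (transitive, asymmetric) on $D$; $\delta\mathcal{P}\delta'$ means $\delta$ has higher priority. An extension $E$ of $\Delta=\langle D,W\rangle$ is a $\mathcal{P}$-preferred$^L$ extension of $\Delta$ if there is a strict total order $\mathcal{T}$ on $D$ such that $\mathcal{P}\subseteq\mathcal{T}$ and for all extensions $E'$ of $\Delta$ and all $\delta\in D$: $\mathrm{appl}(\delta,E',E)$ implies that for some $\epsilon\in D$, $\epsilon\mathcal{T}\delta$ and $\mathrm{appl}(\epsilon,E,E')$. $\Delta\models^L_{\mathcal{P}}\phi$ means that $\phi$ belongs to all $\mathcal{P}$-preferred$^L$ extensions of $\Delta$. *)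

(* Defs.v *)
From HB Require Import structures.
From Corelib Require Import PosDef.
From mathcomp Require Import all_boot all_order all_algebra.
From mathcomp Require Import boolp classical_sets.

Set Implicit Arguments.
Unset Strict Implicit.
Unset Printing Implicit Defensive.

Local Open Scope classical_set_scope.

(** * Classical propositional logic *)

Inductive formula : Type :=
| Var of nat
| Top
| Bot
| Neg of formula
| And of formula & formula
| Or of formula & formula
| Imp of formula & formula.

Fixpoint formula_to_tree (f : formula) : GenTree.tree nat :=
  match f with
  | Var n => GenTree.Leaf n
  | Top => GenTree.Node 0 [::]
  | Bot => GenTree.Node 1 [::]
  | Neg g => GenTree.Node 2 [:: formula_to_tree g]
  | And g h => GenTree.Node 3 [:: formula_to_tree g; formula_to_tree h]
  | Or g h => GenTree.Node 4 [:: formula_to_tree g; formula_to_tree h]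
  | Imp g h => GenTree.Node 5 [:: formula_to_tree g; formula_to_tree h]
  end.

Fixpoint tree_to_formula (t : GenTree.tree nat) : formula :=
  match t with
  | GenTree.Leaf n => Var n
  | GenTree.Node 0 [::] => Top
  | GenTree.Node 2 [:: a] => Neg (tree_to_formula a)
  | GenTree.Node 3 [:: a; b] => And (tree_to_formula a) (tree_to_formula b)
  | GenTree.Node 4 [:: a; b] => Or (tree_to_formula a) (tree_to_formula b)
  | GenTree.Node 5 [:: a; b] => Imp (tree_to_formula a) (tree_to_formula b)
  | _ => Bot
  end.

Lemma formula_to_treeK : cancel formula_to_tree tree_to_formula.
Proof. by elim=> //= [g ->|g -> h ->|g -> h ->|g -> h ->]. Qed.

HB.instance Definition _ := Countable.copy formula (can_type formula_to_treeK).

Fixpoint eval (v : nat -> bool) (f : formula) : bool :=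
  match f with
  | Var n => v n
  | Top => true
  | Bot => false
  | Neg g => ~~ eval v g
  | And g h => eval v g && eval v h
  | Or g h => eval v g || eval v h
  | Imp g h => eval v g ==> eval v h
  end.

Definition entails (S : set formula) (f : formula) : Prop :=
  forall v : nat -> bool, (forall g, S g -> eval v g) -> eval v f.

Definition Cn (S : set formula) : set formula := [set f | entails S f].

Definition literal (f : formula) : Prop :=
  exists p : nat, f = Var p \/ f = Neg (Var p).

(** * Default theories and Reiter extensions *)

Record default := Default {
  prerequisite : formula;
  justifications : seq formula;
  conclusion : formula
}.

Definition default_to_prod (d : default) :=
  (prerequisite d, justifications d, conclusion d).
Definition prod_to_default (x : formula * seq formula * formula) :=
  Default x.1.1 x.1.2 x.2.
Lemma default_to_prodK : cancel default_to_prod prod_to_default.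
Proof. by case. Qed.

HB.instance Definition _ := Countable.copy default (can_type default_to_prodK).

Record theory := Theory {
  defaults : set default;
  facts : set formula
}.

Definition negated_justifications (d : default) : set formula :=
  [set f | exists2 b, b \in justifications d & f = Neg b].

Definition closed_under (Delta : theory) (S G : set formula) : Prop :=
  Cn G = G /\
  forall d, defaults Delta d -> G (prerequisite d) ->
    negated_justifications d `&` S = set0 -> G (conclusion d).

Definition Gamma (Delta : theory) (S : set formula) : set formula :=
  smallest (closed_under Delta S) (facts Delta).

Definition extension (Delta : theory) (E : set formula) : Prop :=
  Gamma Delta E = E.

(** * Preferred extensions *)

Definition applied (d : default) (E : set formula) : Prop :=
  entails E (prerequisite d) /\ negated_justifications d `&` Cn E = set0.

Definition applied_not (d : default) (E E' : set formula) : Prop :=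
  applied d E /\ ~ applied d E'.

(* A pair (d, d') in the relation means that d has higher priority than d'. *)
Definition strict_partial_order (T : Type) (D : set T) (R : set (T * T)) :=
  [/\ R `<=` D `*` D,
      forall x y z, R (x, y) -> R (y, z) -> R (x, z) &
      forall x y, R (x, y) -> ~ R (y, x)].

Definition strict_total_order (T : Type) (D : set T) (R : set (T * T)) :=
  strict_partial_order D R /\
  forall x y, D x -> D y -> x <> y -> R (x, y) \/ R (y, x).

Definition preferred (Delta : theory) (P : set (default * default))
    (E : set formula) : Prop :=
  extension Delta E /\
  exists T : set (default * default),
    [/\ strict_total_order (defaults Delta) T, P `<=` T &
     forall E' d, extension Delta E' -> defaults Delta d ->
       applied_not d E' E ->
       exists e, [/\ defaults Delta e, T (e, d) & applied_not e E E']].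

Definition preferred_entails (Delta : theory) (P : set (default * default))
    (f : formula) : Prop :=
  forall E, preferred Delta P E -> E f.

Definition literal_theory (Delta : theory) : Prop :=
  (forall w, facts Delta w -> literal w) /\
  (forall d, defaults Delta d ->
     exists2 l, literal l & d = Default Top [:: l] l).

(** * Polynomial time on deterministic multi-tape Turing machines *)

Inductive move := MoveL | MoveR | Stay.

(* A machine with input alphabet [S] has [tm_work] work tapes besides the input
   tape, which is tape [ord0] and may also be written.  A tape symbol is [None]
   (blank), [Some (inl s)] with [s] an input symbol, or [Some (inr a)] with [a]
   an auxiliary symbol.  The machine has halted with answer [b] in the states
   [q] such that [tm_out q = Some b]. *)
Record tm (S : finType) := TM {
  tm_work : nat;
  tm_aux : finType;
  tm_state : finType;
  tm_init : tm_state;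
  tm_out : tm_state -> option bool;
  tm_delta : tm_state -> {ffun 'I_tm_work.+1 -> option (S + tm_aux)} ->
    tm_state * {ffun 'I_tm_work.+1 -> option (S + tm_aux) * move}
}.

(* A two-way infinite tape with all but finitely many cells blank: the cells to
   the left of the head, nearest first, the scanned cell, and the cells to the
   right, nearest first; cells beyond either list are blank. *)
Record tape (A : Type) := Tape {
  tape_left : seq (option A);
  tape_head : option A;
  tape_right : seq (option A)
}.

Definition tape_of_seq (A : Type) (w : seq A) : tape A :=
  Tape [::] (ohead w) (map some (behead w)).

Definition tape_write (A : Type) (t : tape A) (a : option A) : tape A :=
  Tape (tape_left t) a (tape_right t).

Definition tape_move (A : Type) (t : tape A) (m : move) : tape A :=
  match m with
  | MoveL => Tape (behead (tape_left t)) (head None (tape_left t))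
                  (tape_head t :: tape_right t)
  | MoveR => Tape (tape_head t :: tape_left t) (head None (tape_right t))
                  (behead (tape_right t))
  | Stay => t
  end.

Definition config (S : finType) (M : tm S) : Type :=
  tm_state M * ('I_(tm_work M).+1 -> tape (S + tm_aux M)).

(* The input is written on tape [ord0] with the head on its first symbol; the
   work tapes are blank. *)
Definition init_config (S : finType) (M : tm S) (w : seq S) : config M :=
  (tm_init M,
   fun i => if i == ord0 then tape_of_seq (map inl w) else tape_of_seq [::]).

(* A halted configuration is left unchanged. *)
Definition step (S : finType) (M : tm S) (c : config M) : config M :=
  if tm_out c.1 is Some _ then c else
  let: (q, act) := tm_delta c.1 [ffun i => tape_head (c.2 i)] in
  (q, fun i => tape_move (tape_write (c.2 i) (act i).1) (act i).2).

Definition answers_within (S : finType) (M : tm S) (w : seq S) (t : nat)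
    (b : bool) : Prop :=
  tm_out (iter t (@step S M) (init_config M w)).1 = Some b.

(* The problem, given an instance in [valid], of testing whether it is in [Q];
   running time is measured in the length of the encoding of the instance. *)
Definition polytime_testable (S : finType) (A : Type) (encode : A -> seq S)
    (valid Q : set A) : Prop :=
  exists (M : tm S) (p : {poly nat}), forall a, valid a ->
    exists b : bool,
      answers_within M (encode a) p.[size (encode a)]%R b /\
      (b <-> Q a).

(** * Instances and their encoding as strings *)

Inductive symbol :=
| SVar | SZero | SOne | STop | SBot | SNeg | SAnd | SOr | SImp
| SColon | SComma | SSlash | SLess | SSemicolon | SHash.

Definition symbols : seq symbol :=
  [:: SVar; SZero; SOne; STop; SBot; SNeg; SAnd; SOr; SImp;
      SColon; SComma; SSlash; SLess; SSemicolon; SHash].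

Definition symbol_to_ord (s : symbol) : 'I_15 :=
  match s with
  | SVar => inord 0 | SZero => inord 1 | SOne => inord 2 | STop => inord 3
  | SBot => inord 4 | SNeg => inord 5 | SAnd => inord 6 | SOr => inord 7
  | SImp => inord 8 | SColon => inord 9 | SComma => inord 10
  | SSlash => inord 11 | SLess => inord 12 | SSemicolon => inord 13
  | SHash => inord 14
  end.
Definition ord_to_symbol (i : 'I_15) : symbol := nth SVar symbols i.
Lemma symbol_to_ordK : cancel symbol_to_ord ord_to_symbol.
Proof. by case; rewrite /ord_to_symbol inordK. Qed.

HB.instance Definition _ := Finite.copy symbol (can_type symbol_to_ordK).

(* Binary digits, least significant first. *)
Fixpoint encode_pos (p : positive) : seq symbol :=
  match p with
  | xH => [:: SOne]
  | xO q => SZero :: encode_pos q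
  | xI q => SOne :: encode_pos q
  end.

Definition encode_nat (n : nat) : seq symbol :=
  if bin_of_nat n is Npos p then encode_pos p else [::].

(* Polish notation; the digits of a variable extend up to the next symbol that
   is not a digit. *)
Fixpoint encode_formula (f : formula) : seq symbol :=
  match f with
  | Var n => SVar :: encode_nat n
  | Top => [:: STop]
  | Bot => [:: SBot]
  | Neg g => SNeg :: encode_formula g
  | And g h => SAnd :: encode_formula g ++ encode_formula h
  | Or g h => SOr :: encode_formula g ++ encode_formula h
  | Imp g h => SImp :: encode_formula g ++ encode_formula h
  end.

Definition encode_default (d : default) : seq symbol :=
  encode_formula (prerequisite d) ++
  SColon :: flatten [seq encode_formula b ++ [:: SComma] | b <- justifications d]
  ++ SSlash :: encode_formula (conclusion d).

Definition encode_pair (x : default * default) : seq symbol :=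
  encode_default x.1 ++ SLess :: encode_default x.2.

Definition encode_list (A : Type) (enc : A -> seq symbol) (s : seq A) :=
  flatten [seq enc x ++ [:: SSemicolon] | x <- s] ++ [:: SHash].

(* Finite sets are given by listing their elements, in any order and possibly
   with repetitions. *)
Record instance := Instance {
  inst_defaults : seq default;
  inst_facts : seq formula;
  inst_priority : seq (default * default);
  inst_query : formula
}.

Definition inst_theory (I : instance) : theory :=
  Theory [set` inst_defaults I] [set` inst_facts I].

Definition encode_instance (I : instance) : seq symbol :=
  encode_list encode_default (inst_defaults I) ++
  encode_list encode_formula (inst_facts I) ++
  encode_list encode_pair (inst_priority I) ++
  encode_formula (inst_query I).

(* Main.v *)
From HB Require Import structures.
Require Import Defs.
From mathcomp Require Import all_boot all_order all_algebra.
From mathcomp Require Import boolp classical_sets.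
From mathcomp Require Import zify.

(** If [W] is inconsistent, every formula is in every extension.  Otherwise the
extensions are obtained by choosing one literal of each pair of complementary
literals that both have a default and are not decided by [W].  Changing a single
choice shows that an extension is preferred for a total order [T] exactly when it
contains the [T]-first literal of every such pair.  As [P] is transitive, [P] has
a linear extension putting the default of the complement of [l] before that of
[l] unless [P] orders them the other way.  Hence [l] is entailed iff [W] is
inconsistent, or [l] is in [W], or the complement of [l] is not in [W], [:l/l] is
a default, and the complement of [l] has no default or one that is lower for [P].

The length of variable names is unbounded, so this test needs comparisons of
substrings.  They are done by a two-head finite automaton; a Turing machine gets
the second head by copying its input, and needs a number of steps bounded by the
number of configurations of the automaton, which is quadratic. *)

Set Implicit Arguments.
Unset Strict Implicit.
Unset Printing Implicit Defensive.

Local Open Scope classical_set_scope.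

(** * Two-head automata as Turing machines *)

(* The tape shows the word [u] with its head on cell [i]; trailing blanks of the
   two lists are not observable, which is why only [nth] is constrained. *)
Definition shows (A : Type) (t : tape A) (u : seq (option A)) (i : nat) : Prop :=
  [/\ tape_head t = nth None u i,
      forall k, nth None (tape_left t) k =
        if (k < i)%N then nth None u (i - k.+1) else None &
      forall k, nth None (tape_right t) k = nth None u (i + k.+1)].

(** A relation rather than a function of [i], so that no left move starts from cell [0]. *)
Definition moves_to (m : move) (i j : nat) : bool :=
  match m with
  | MoveL => i == j.+1
  | MoveR => j == i.+1
  | Stay => i == j
  end.

Lemma shows_move (A : Type) (t : tape A) u i m j :
  shows t u i -> moves_to m i j -> shows (tape_move t m) u j.
Proof.
case: t => l a r [/= ha hl hr].
case: m => /= /eqP ij; [subst i|subst j|by subst j; split].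
- split=> /= [|k|[|k]].
  + by rewrite -nth0 hl /= subSS subn0.
  + by rewrite nth_behead hl ltnS subSS.
  + by rewrite /= ha addn1.
  + by rewrite /= hr addSnnS.
- split=> /= [|[|k]|k].
  + by rewrite -nth0 hr addn1.
  + by rewrite /= ha subn1.
  + by rewrite /= hl ltnS subSS.
  + by rewrite nth_behead hr addSnnS.
Qed.

Lemma shows_write (A : Type) (t : tape A) u i a :
  shows t u i -> shows (tape_write t a) (set_nth None u i a) i.
Proof.
case: t => l b r [/= _ hl hr]; split=> /= [|k|k].
- by rewrite nth_set_nth /= eqxx.
- rewrite hl; case: ifP => // ki.
  by rewrite nth_set_nth /= ltn_eqF // ltn_subrL (leq_ltn_trans _ ki).
- by rewrite hr nth_set_nth /= gtn_eqF // -addSnnS leq_addr.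
Qed.

Lemma tape_write_head (A : Type) (t : tape A) : tape_write t (tape_head t) = t.
Proof. by case: t. Qed.

Record two_head (S : finType) := TwoHead {
  th_state : finType;
  th_init : th_state;
  th_out : th_state -> option bool;
  th_delta : th_state -> option S -> option S -> th_state * move * move
}.

(* Cell [0] is the blank before the word [w]. *)
Definition cell (S : Type) (w : seq S) (i : nat) : option S :=
  nth None (None :: map some w) i.

(** [size w] cells hold the word; the two others are the blanks on either side of it. *)
Definition th_config (S : finType) (H : two_head S) (w : seq S) : finType :=
  (th_state H * 'I_(size w).+2 * 'I_(size w).+2)%type.

Definition th_edge (S : finType) (H : two_head S) (w : seq S) :
    rel (th_config H w) :=
  fun c d =>
    let: (q, i, j) := c in
    let: (q', i', j') := d in
    let: (r, m, m') := th_delta q (cell w i) (cell w j) in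
    [&& th_out q == None, q' == r, moves_to m i i' & moves_to m' j j'].

Definition th_reach (S : finType) (H : two_head S) (w : seq S) (q : th_state H)
    (i j : nat) (q' : th_state H) (i' j' : nat) : Prop :=
  connect (th_edge (w := w)) (q, inord i, inord j) (q', inord i', inord j').

Lemma th_reach_trans (S : finType) (H : two_head S) (w : seq S)
    (q : th_state H) i j q1 i1 j1 q2 i2 j2 :
  th_reach w q i j q1 i1 j1 -> th_reach w q1 i1 j1 q2 i2 j2 ->
  th_reach w q i j q2 i2 j2.
Proof. exact: connect_trans. Qed.

Lemma th_reach_step (S : finType) (H : two_head S) (w : seq S)
    (q : th_state H) i j q' m m' i' j' :
  (maxn i j <= (size w).+1)%N -> (maxn i' j' <= (size w).+1)%N ->
  th_out q = None -> th_delta q (cell w i) (cell w j) = (q', m, m') ->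
  moves_to m i i' -> moves_to m' j j' -> th_reach w q i j q' i' j'.
Proof.
rewrite !geq_max => /andP[hi hj] /andP[hi' hj'] qN dq mi mj.
by apply: connect1; rewrite /= !inordK // dq qN !eqxx mi mj.
Qed.

Definition strip (S : Type) (a : option (S + void)) : option S :=
  if a is Some (inl s) then Some s else None.

(* In state [None] the machine copies the input onto the second tape; afterwards
   both tapes hold the same word, which is never overwritten. *)
Definition tm_of_two_head (S : finType) (H : two_head S) : tm S :=
  @TM S 1 void (option (th_state H)) None
    (fun q => if q is Some q then th_out q else None)
    (fun q f =>
      if q is Some q then
        let: (q', m, m') := th_delta q (strip (f ord0)) (strip (f ord_max)) in
        (Some q', [ffun i => (f i, if i == ord0 then m else m')])
      else if f ord0 is Some s then (None, [ffun _ => (Some s, MoveR)])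
      else (Some (th_init H), [ffun _ => (None, MoveL)])).

Definition blanked (S : Type) (w : seq S) : seq (option (S + void)) :=
  None :: [seq Some (inl s) | s <- w].

Lemma strip_blanked (S : Type) (w : seq S) i :
  strip (nth None (blanked w) i) = cell w i.
Proof.
rewrite /cell /blanked; case: i => //= i.
by elim: w i => [|s w IH] [|i] /=.
Qed.

Definition simulates (S : finType) (H : two_head S) (w : seq S)
    (c : th_config H w) (C : config (tm_of_two_head H)) : Prop :=
  [/\ C.1 = Some c.1.1, shows (C.2 ord0) (blanked w) c.1.2 &
      shows (C.2 ord_max) (blanked w) c.2].

Lemma step_simulates (S : finType) (H : two_head S) (w : seq S)
    (c d : th_config H w) C :
  th_edge c d -> simulates c C -> simulates d (step C).
Proof.
case: c => [[q i] j]; case: d => [[q' i'] j']; case: C => [Q t] /=.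
rewrite /simulates /step => e [/= -> s0 s1].
have h0 : strip (tape_head (t ord0)) = cell w i.
  by case: s0 => -> _ _; rewrite strip_blanked.
have h1 : strip (tape_head (t ord_max)) = cell w j.
  by case: s1 => -> _ _; rewrite strip_blanked.
rewrite /= !ffunE h0 h1; move: e.
case: (th_delta q (cell w i) (cell w j)) => [[r m] m'] /and4P[/eqP -> /eqP -> mi mj].
by rewrite /= !ffunE !tape_write_head /=; split=> //; apply: shows_move; eassumption.
Qed.

Lemma path_simulates (S : finType) (H : two_head S) (w : seq S) p
    (c : th_config H w) C :
  path (@th_edge S H w) c p -> simulates c C ->
  simulates (last c p) (iter (size p) (@step S _) C).
Proof.
elim: p c C => //= d p IH c C /andP[e ep] sC.
by rewrite -iterS iterSr; apply: IH => //; apply: step_simulates sC.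
Qed.

(** Both heads advance together; they are on cell [k.+1] after [k] steps because cell [0] is the
    blank before the word. *)
Lemma copy_input (S : finType) (H : two_head S) (w : seq S) k :
  (k <= size w)%N ->
  let C := iter k (@step S _) (init_config (tm_of_two_head H) w) in
  [/\ C.1 = None, shows (C.2 ord0) (blanked w) k.+1 &
      shows (C.2 ord_max) (blanked (take k w)) k.+1].
Proof.
elim: k => [|k IH] kw /=.
  rewrite take0; split=> //=.
    split=> [|[|k]|k] //=; rewrite ?nth_nil //.
    - by case: w {kw}.
    - by case: w {kw} => //= [|s w]; rewrite ?nth_nil -?map_comp.
  by split=> [|[|k]|k] //=; rewrite ?nth_nil.
have [] := IH (ltnW kw); case: (iter _ _ _) => Q t /= -> s0 s1.
have [s ws] : exists s, onth w k = Some s.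
  by elim: w k kw {s0 s1 IH} => [|x w IH] [|k] //=; [exists x|apply: IH].
have h0 : tape_head (t ord0) = Some (inl s).
  case: s0 => -> _ _; rewrite /blanked /=.
  by elim: w k ws {s1 kw IH} => [|x w IH] [|k] //= => [[->]|/IH].
rewrite /step /= !ffunE h0 /= !ffunE /=; split=> //.
  by rewrite -h0; apply: (shows_move s0 (m := MoveR)) => /=.
apply: (@shows_move _ (tape_write (t ord_max) _) _ k.+1 MoveR) => //=.
(* Cell [k.+1] is the blank just after the copied prefix, so writing there appends [s]. *)
suff -> : blanked (take k.+1 w) =
    set_nth None (blanked (take k w)) k.+1 (Some (inl s)) by apply: shows_write.
rewrite /blanked /=; congr (_ :: _).
elim: w k ws {s0 s1 IH h0 kw} => [|x w IH] [|k] //= => [[->]|/IH -> //].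
by rewrite take0.
Qed.

(** One step beyond the copy: the blank after the word is read, and both heads return to cell
    [size w]. *)
Lemma copied_input (S : finType) (H : two_head S) (w : seq S) :
  @simulates S H w (th_init H, inord (size w), inord (size w))
    (iter (size w).+1 (@step S _) (init_config (tm_of_two_head H) w)).
Proof.
have [] := @copy_input S H w (size w) (leqnn _); rewrite iterS.
case: (iter _ _ _) => Q t /= -> s0 s1; rewrite take_size in s1.
have h0 : tape_head (t ord0) = None.
  by case: s0 => -> _ _; rewrite /blanked /= nth_default // size_map.
have h1 : tape_head (t ord_max) = None.
  by case: s1 => -> _ _; rewrite /blanked /= nth_default // size_map.
rewrite /step /= !ffunE h0 /simulates /= !ffunE /= inordK //; split=> //.
- by have := shows_move s0 (m := MoveL) (j := size w); rewrite /= h0; apply.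
- by have := shows_move s1 (m := MoveL) (j := size w); rewrite /= h1; apply.
Qed.

Lemma step_halted (S : finType) (M : tm S) (C : config M) b k :
  tm_out C.1 = Some b -> iter k (@step S M) C = C.
Proof. by move=> Cb; elim: k => //= k ->; rewrite /step Cb. Qed.

(* A shortest path visits every configuration at most once, so the number of
   configurations bounds the running time. *)
Lemma polytime_of_two_head (S : finType) (H : two_head S) (A : Type)
    (encode : A -> seq S) (valid Q : set A) :
  (forall a, valid a -> exists q i j (b : bool),
     [/\ th_reach (encode a) (th_init H) (size (encode a)) (size (encode a)) q i j,
         th_out q = Some b & b <-> Q a]) ->
  polytime_testable encode valid Q.
Proof.
move=> HQ; exists (tm_of_two_head H).
(* [X + 1] steps copy the input; the rest counts configurations, each a state and two of the [X + 2]
   cells. *)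
exists ('X + 1%:P + (#|th_state H|)%:P * ('X + 2%:P) ^+ 2)%R => a /HQ.
move=> [q [i [j [b [qr qb bQ]]]]]; exists b; split=> //.
set w := encode a in qr *.
rewrite !(hornerD, hornerM, hornerX, hornerC, horner_exp).
set t := (_ + _)%R; move: qr => /connectP[p0].
case/shortenP => p ep up _ lp.
have := path_simulates ep (@copied_input S H w); rewrite -lp -iterD => -[sq _ _].
have le : (size p + (size w).+1 <= t)%N.
  have -> : t = (#|th_config H w| + (size w).+1)%N.
    rewrite /t !card_prod !card_ord [RHS]addnC -mulnA.
    by rewrite -(addn2 (size w)) -(addn1 (size w)).
  rewrite leq_add2r; case/andP: up => _ /card_uniqP <-; exact: max_card.
(* A halted configuration stays put, so the answer is still there at time [t]. *)
rewrite /answers_within -(subnK le) iterD.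
by rewrite (@step_halted _ _ _ b) sq.
Qed.

(** * Nested scans *)

Definition is_digit (s : symbol) : bool :=
  match s with SZero | SOne => true | _ => false end.

Definition is_var (s : symbol) : bool := if s is SVar then true else false.

Fixpoint digits (w : seq symbol) : seq symbol :=
  if w is s :: w' then if is_digit s then s :: digits w' else [::] else [::].

(* The outer scan runs through the input and, at every variable, calls an inner
   scan of the whole input, which is told at each variable it meets whether that
   is the same variable. *)
Record nested_scan := NestedScan {
  ns_outer : finType;
  ns_inner : finType;
  ns_start : ns_outer;
  ns_step : ns_outer -> symbol -> ns_outer;
  ns_enter : ns_inner;
  ns_istep : ns_inner -> symbol -> bool -> ns_inner;
  ns_leave : ns_outer -> ns_inner -> ns_outer;
  ns_accept : ns_outer -> bool
}.

Fixpoint inner_scan (N : nested_scan) (ref : seq symbol) (x : ns_inner N)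
    (w : seq symbol) : ns_inner N :=
  if w is s :: w' then
    inner_scan ref (ns_istep x s (is_var s && (digits w' == ref))) w'
  else x.

Fixpoint outer_scan (N : nested_scan) (input : seq symbol) (y : ns_outer N)
    (w : seq symbol) : ns_outer N :=
  if w is s :: w' then
    outer_scan input
      (if is_var s
       then ns_leave y (inner_scan (digits w') (ns_enter N) input)
       else ns_step y s) w'
  else y.

Definition ns_decides (N : nested_scan) (w : seq symbol) : bool :=
  ns_accept (outer_scan w (ns_start N) w).

Inductive phase := Home | Outer | Inner | Compare | Back | Rewind | Done.

Definition phases := [:: Home; Outer; Inner; Compare; Back; Rewind; Done].

Definition phase_to_ord (h : phase) : 'I_7 :=
  match h with
  | Home => @Ordinal 7 0 isT | Outer => @Ordinal 7 1 isT
  | Inner => @Ordinal 7 2 isT | Compare => @Ordinal 7 3 isT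
  | Back => @Ordinal 7 4 isT | Rewind => @Ordinal 7 5 isT
  | Done => @Ordinal 7 6 isT
  end.

Lemma phase_to_ordK : cancel phase_to_ord (fun i => nth Home phases i).
Proof. by case. Qed.

HB.instance Definition _ := Finite.copy phase (can_type phase_to_ordK).

(* In phase [Compare] the heads advance together through equal digits; in phase
   [Back] they return together, until the first head is back on its variable. *)
Definition scanner (N : nested_scan) : two_head symbol :=
  @TwoHead symbol (phase * ns_outer N * ns_inner N)%type
    (Home, ns_start N, ns_enter N)
    (fun q => if q.1.1 is Done then Some (ns_accept q.1.2) else None)
    (fun q a b => let: (h, y, x) := q in
      match h with
      | Home => if a is Some _ then ((Home, y, x), MoveL, MoveL)
                else ((Outer, y, x), MoveR, Stay)
      | Outer => if a is Some s then
                   if is_var s then ((Inner, y, ns_enter N), Stay, MoveR)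
                   else ((Outer, ns_step y s, x), MoveR, Stay)
                 else ((Done, y, x), Stay, Stay)
      | Inner => if b is Some s then
                   if is_var s then ((Compare, y, x), MoveR, MoveR)
                   else ((Inner, y, ns_istep x s false), Stay, MoveR)
                 else ((Rewind, ns_leave y x, x), Stay, MoveL)
      | Compare => if oapp is_digit false a && (a == b)
                   then ((Compare, y, x), MoveR, MoveR)
                   else ((Back, y, ns_istep x SVar
                            (~~ oapp is_digit false a && ~~ oapp is_digit false b)),
                         MoveL, MoveL)
      | Back => if oapp is_var false a then ((Inner, y, x), Stay, MoveR)
                else ((Back, y, x), MoveL, MoveL)
      | Rewind => if b is Some _ then ((Rewind, y, x), Stay, MoveL)
                  else ((Outer, y, x), MoveR, Stay)
      | Done => (q, Stay, Stay)
      end).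

(** * Correctness of the scanner *)

Lemma cell_drop (T : Type) (w : seq T) i : cell w i.+1 = ohead (drop i w).
Proof. by rewrite /cell /=; elim: w i => [|s w IH] [|i] //=; rewrite nth_nil. Qed.

Lemma drop_cons_lt (T : Type) (w : seq T) i s v :
  drop i w = s :: v -> drop i.+1 w = v /\ (i < size w)%N.
Proof.
move=> e; split; first by rewrite -[i.+1]add1n -drop_drop e /= drop0.
by rewrite ltnNge; apply/negP => /drop_oversize; rewrite e.
Qed.

Ltac scanner_step tac :=
  apply: th_reach_step;
  [ | | reflexivity | rewrite /= ?cell_drop; tac | | ];
  rewrite //= ?geq_max; try lia.

Lemma scanner_home (N : nested_scan) (w : seq symbol) y x k : (k <= size w)%N ->
  @th_reach _ (scanner N) w (Home, y, x) k k (Outer, y, x) 1 0.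
Proof.
elim: k => [|k IH] kw; first by scanner_step ltac:(done).
apply: th_reach_trans (IH (ltnW kw)).
have := drop_nth SVar kw => e.
by scanner_step ltac:(rewrite e).
Qed.

Lemma scanner_rewind (N : nested_scan) (w : seq symbol) y x i j :
  (i < size w)%N -> (j <= size w)%N ->
  @th_reach _ (scanner N) w (Rewind, y, x) i.+1 j (Outer, y, x) i.+2 0.
Proof.
move=> iw; elim: j => [|j IH] jw; first by scanner_step ltac:(done).
apply: th_reach_trans (IH (ltnW jw)).
have := drop_nth SVar jw => e.
by scanner_step ltac:(rewrite e).
Qed.

(** Where the common run of digits stops, the two digit strings are equal iff neither scanned symbol
    is a digit. The heads come back one cell before their starting points. *)
Lemma scanner_compare (N : nested_scan) (w u v : seq symbol) y x i j :
  drop i w = u -> drop j w = v -> (i <= size w)%N -> (j <= size w)%N ->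
  @th_reach _ (scanner N) w (Compare, y, x) i.+1 j.+1
    (Back, y, ns_istep x SVar (digits u == digits v)) i j.
Proof.
elim: u v i j => [|s u IH] v i j ui vj iw jw.
  have e : ~~ oapp is_digit false (ohead v) = (digits [::] == digits v).
    by case: v {vj} => //= t v; case: is_digit.
  by scanner_step ltac:(rewrite ui vj /= e).
have [su iw'] := drop_cons_lt ui.
case: v vj => [|t v] vj.
  have e : ~~ is_digit s = (digits (s :: u) == digits [::]).
    by rewrite /=; case: is_digit.
  by scanner_step ltac:(rewrite ui vj /= andbF andbT e).
have [tv jw'] := drop_cons_lt vj.
case: (boolP (is_digit s && (s == t))) => [/andP[sd /eqP st]|st].
  have -> : (digits (s :: u) == digits (t :: v)) = (digits u == digits v).
    by rewrite -st /= sd eqseq_cons eqxx.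
  apply: (@th_reach_trans _ (scanner N) _ _ _ _ (Compare, y, x) i.+2 j.+2).
    by scanner_step ltac:(rewrite ui vj /= -st sd eqxx).
  apply: th_reach_trans (IH v _ _ su tv iw' jw') _.
  (* The first head is on the digit [s], not on a variable, so [Back] takes both heads one cell
     further left. *)
  by scanner_step ltac:(rewrite ui /=; case: (s) sd).
have e : ~~ is_digit s && ~~ is_digit t = (digits (s :: u) == digits (t :: v)).
  rewrite /=; case: (is_digit s) st => /= [st|_]; last by case: is_digit.
  by case: is_digit => //; rewrite eqseq_cons (negPf st).
have es : (Some s == Some t) = (s == t) by [].
by scanner_step ltac:(rewrite ui vj /= es (negbTE st) e).
Qed.

(** The first head waits on its variable and leaves it only to compare; since only digits are
    crossed, the variable found by [Back] is the right one. The leftover [x'] may be anything: the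
    next call restarts from [ns_enter]. *)
Lemma scanner_inner (N : nested_scan) (w v : seq symbol) y x i j :
  (i < size w)%N -> cell w i.+1 = Some SVar -> drop j w = v -> (j <= size w)%N ->
  exists x',
  @th_reach _ (scanner N) w (Inner, y, x) i.+1 j.+1
    (Outer, ns_leave y (inner_scan (digits (drop i.+1 w)) x v), x') i.+2 0.
Proof.
move=> iw wi; elim: v x j => [|s v IH] x j vj jw.
  exists x; apply: th_reach_trans (scanner_rewind _ _ iw jw).
  by scanner_step ltac:(rewrite vj).
have [sv jw'] := drop_cons_lt vj.
have [x' IHx] :=
  IH (ns_istep x s (is_var s && (digits v == digits (drop i.+1 w)))) _ sv jw'.
exists x'; apply: th_reach_trans IHx.
case sV: (is_var s) => /=; last by scanner_step ltac:(rewrite vj /= sV).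
case: s sV vj => // _ vj.
apply: (@th_reach_trans _ (scanner N) _ _ _ _ (Compare, y, x) i.+2 j.+2).
  by scanner_step ltac:(rewrite vj).
apply: th_reach_trans (scanner_compare _ _ erefl sv iw jw') _.
by rewrite eq_sym; scanner_step ltac:(rewrite -cell_drop wi).
Qed.

Lemma scanner_outer (N : nested_scan) (w v : seq symbol) y x i :
  drop i w = v -> (i <= size w)%N ->
  exists x' i', @th_reach _ (scanner N) w (Outer, y, x) i.+1 0
    (Done, outer_scan w y v, x') i' 0.
Proof.
elim: v y x i => [|s v IH] y x i vi iw.
  by exists x, i.+1; scanner_step ltac:(rewrite vi).
have [sv iw'] := drop_cons_lt vi.
case sV: (is_var s); last first.
  have [x' [i' r]] := IH (ns_step y s) x _ sv iw'.
  exists x', i'; rewrite /= sV; apply: th_reach_trans r.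
  by scanner_step ltac:(rewrite vi /= sV).
have wi : cell w i.+1 = Some SVar by rewrite cell_drop vi; case: (s) sV.
have [x1 r1] := @scanner_inner N w w y (ns_enter N) i 0 iw' wi (drop0 _) isT.
rewrite sv in r1.
have [x' [i' r2]] :=
  IH (ns_leave y (inner_scan (digits v) (ns_enter N) w)) x1 _ sv iw'.
exists x', i'; rewrite /= sV; apply: th_reach_trans r2; apply: th_reach_trans r1.
by scanner_step ltac:(rewrite vi /= sV).
Qed.

Lemma polytime_of_nested_scan (N : nested_scan) (A : Type)
    (encode : A -> seq symbol) (valid Q : set A) :
  (forall a, valid a -> ns_decides N (encode a) <-> Q a) ->
  polytime_testable encode valid Q.
Proof.
move=> NQ; apply: (@polytime_of_two_head _ (scanner N)) => a /NQ aQ.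
have [x [i r]] :=
  @scanner_outer N _ _ (ns_start N) (ns_enter N) 0 (drop0 (encode a)) isT.
exists (Done, outer_scan (encode a) (ns_start N) (encode a), x), i, 0.
exists (ns_decides N (encode a)); split=> //.
exact: th_reach_trans (scanner_home _ _ (leqnn _)) r.
Qed.

(** * Linear extensions *)

(* Sort by the number of predecessors, breaking ties arbitrarily. *)
Lemma linear_extension (T : countType) (s : seq T) (R : set (T * T)) :
  strict_partial_order [set` s] R ->
  exists2 L, strict_total_order [set` s] L & R `<=` L.
Proof.
move=> [Rs Rtrans Rasym].
pose h x := count (fun z => `[< R (z, x) >]) s.
have hR x y : R (x, y) -> (h x < h y)%N.
  move=> xy; have [xs _] := Rs _ xy.
  (* Predecessors of [x], and [x] itself, are predecessors of [y]; irreflexivity makes the two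
     counts disjoint. *)
  have e : (h x + count (pred1 x) s <= h y)%N.
    rewrite /h -count_predUI (@eq_count _ (predI _ _) pred0) ?count_pred0 ?addn0.
      apply: sub_count => z /orP[/asboolP zx|/eqP ->]; apply/asboolP => //.
      exact: Rtrans xy.
    move=> z /=; apply/negP => /andP[/asboolP zx /eqP zE].
    by rewrite zE in zx; exact: (Rasym _ _ zx).
  apply: leq_trans e; rewrite -addn1 leq_add2l -has_count has_pred1; exact: xs.
exists [set xy | [/\ xy.1 \in s, xy.2 \in s &
    (h xy.1 < h xy.2)%N || (h xy.1 == h xy.2) && (pickle xy.1 < pickle xy.2)%N]].
  split; first split.
  - by move=> [x y] [/= ? ? _].
  - move=> x y z [/= xs ys xy] [/= _ zs yz]; split=> //=; lia.
  - move=> x y [/= xs ys xy] [/= _ _ yx]; lia.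
  move=> x y xs ys xy; have : pickle x <> pickle y.
    by move=> e; apply: xy; apply: (pcan_inj pickleK).
  move=> pxy; have [o|o] :
    (h x < h y)%N || (h x == h y) && (pickle x < pickle y)%N \/
    (h y < h x)%N || (h y == h x) && (pickle y < pickle x)%N by lia.
  - by left.
  - by right.
by move=> [x y] xy; have [xs ys] := Rs _ xy; split=> //=; rewrite hR.
Qed.

(** Take the transitive closure after adding [(a, b)]: the new pairs [(x, y)] have [x] below or
    equal to [a] and [b] below or equal to [y]. A cycle would put [b] below or equal to [a]. *)
Lemma strict_partial_order_add (T : Type) (D : set T) (R : set (T * T)) a b :
  strict_partial_order D R -> D a -> D b -> a <> b -> ~ R (b, a) ->
  exists R', [/\ strict_partial_order D R', R `<=` R' & R' (a, b)].
Proof.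
move=> [RD Rtrans Rasym] Da Db ab nba.
pose le x y := x = y \/ R (x, y).
have le_trans x y z : le x y -> le y z -> le x z.
  by move=> [->|xy] [<-|yz]; rewrite /le; auto; right; apply: Rtrans xy yz.
have nle : ~ le b a by case=> // e; apply: ab.
have leR x y z : le x y -> R (y, z) -> le x z.
  by move=> xy yz; apply: le_trans xy _; right.
have Rle x y z : R (x, y) -> le y z -> le x z.
  by move=> xy yz; apply: le_trans yz; right.
exists [set xy | R xy \/ le xy.1 a /\ le b xy.2]; split; last 2 first.
- by left.
- by right; split; left.
split.
- move=> [x y] [/RD //|[/= xa by_]]; split=> /=.
  + by case: xa => [->//|/RD[]].
  + by case: by_ => [<-//|/RD[]].
- move=> x y z [xy|[/= xa by_]] [yz|[/= ya bz]].
  + by left; apply: Rtrans xy yz.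
  + by right; split=> //=; apply: Rle xy ya.
  + by right; split=> //=; apply: leR by_ yz.
  + by case: nle; apply: le_trans by_ ya.
- move=> x y [xy|[/= xa by_]] [yx|[/= ya bx]].
  + exact: (Rasym _ _ xy).
  + by apply: nle; apply: le_trans bx _; apply: Rle xy ya.
  + by apply: nle; apply: le_trans by_ _; apply: Rle yx xa.
  + by apply: nle; apply: le_trans by_ ya.
Qed.

(** * Extensions of literal theories *)

(* A pair [(p, b)] stands for the literal on variable [p] true when [p] is [b]. *)
Definition lit (x : nat * bool) : formula :=
  if x.2 then Var x.1 else Neg (Var x.1).

Definition cpl (x : nat * bool) : nat * bool := (x.1, ~~ x.2).

Lemma cplK : involutive cpl.
Proof. by case=> p b; rewrite /cpl /= negbK. Qed.

Lemma cpl_neq x : x <> cpl x.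
Proof. by case: x => p [] []. Qed.

Lemma eval_lit v x : eval v (lit x) = (v x.1 == x.2).
Proof. by case: x => p [] /=; case: (v p). Qed.

Lemma eval_Neg_lit v x : eval v (Neg (lit x)) = eval v (lit (cpl x)).
Proof. by rewrite /= !eval_lit /=; case: (v x.1); case: x.2. Qed.

Lemma lit_inj : injective lit.
Proof. by case=> p [] [q []] //= [->]. Qed.

Definition lit_default (x : nat * bool) : default :=
  Default Top [:: lit x] (lit x).

Lemma lit_default_inj : injective lit_default.
Proof. by move=> x y [/lit_inj]. Qed.

Definition lit_theory (D W : seq (nat * bool)) : theory :=
  Theory [set` map lit_default D] [set` map lit W].

Definition consistent (B : set (nat * bool)) : Prop :=
  forall x, B x -> ~ B (cpl x).

Lemma sub_Cn S : S `<=` Cn S.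
Proof. by move=> f Sf v; apply. Qed.

Lemma Cn_mono S S' : S `<=` S' -> Cn S `<=` Cn S'.
Proof. by move=> SS f Sf v vS; apply: Sf => g /SS /vS. Qed.

Lemma CnK S : Cn (Cn S) = Cn S.
Proof.
rewrite eqEsubset; split; last exact: sub_Cn.
by move=> f Sf v vS; apply: Sf => g; apply.
Qed.

Lemma Cn_Neg_lit S x : Cn S (Neg (lit x)) <-> Cn S (lit (cpl x)).
Proof.
by split=> Sx v vS; have := Sx v vS; rewrite eval_Neg_lit.
Qed.

(** If [x] is not in [B], the valuation that falsifies [x] and follows [B] on all other variables is
    a model of [B]. *)
Lemma Cn_lit B x : consistent B -> Cn (lit @` B) (lit x) -> B x.
Proof.
move=> Bc Bx; apply: contrapT => nBx.
pose v p := if p == x.1 then ~~ x.2 else `[< B (p, true) >].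
suff vB g : (lit @` B) g -> eval v g.
  by have := Bx v vB; rewrite eval_lit /v eqxx; case: x.2.
move=> [[p b] Bpb <-]; rewrite eval_lit /v /=.
case: (eqVneq p x.1) => [px|_].
  case: (eqVneq b x.2) => [bx|]; last by case: (b); case: x.2.
  by case: nBx; rewrite (surjective_pairing x) -px -bx.
case: b Bpb => Bpb; first exact/eqP/asboolP.
by apply/eqP/asboolP => /(Bc _) /=; apply.
Qed.

Lemma not_consistent_Cn B S f : ~ consistent B -> lit @` B `<=` S -> Cn S f.
Proof.
move=> /existsNP[x /not_implyP[Bx /contrapT Bcx]] BS v vS.
have := vS _ (BS _ (imageP lit Bx)); have := vS _ (BS _ (imageP lit Bcx)).
by rewrite !eval_lit /=; case: (v x.1); case: x.2.
Qed.

(** [Gamma] is an intersection of deductively closed sets. *)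
Lemma extension_Cn Delta E : extension Delta E -> Cn E = E.
Proof.
move=> ext.
rewrite eqEsubset; split; last exact: sub_Cn.
rewrite -{2}ext => f Ef G [[GC Gd] WG].
by rewrite -GC; apply: Cn_mono Ef; rewrite -ext; apply: smallest_sub.
Qed.

Lemma extension_facts Delta E : extension Delta E -> facts Delta `<=` E.
Proof. by move=> <-; apply: sub_gen_smallest. Qed.

Lemma extension_closed Delta E d : extension Delta E -> defaults Delta d ->
  E (prerequisite d) -> negated_justifications d `&` E = set0 ->
  E (conclusion d).
Proof.
move=> ext Dd Ep Ej; rewrite -ext => G [[GC Gd] WG].
apply: (Gd) => //; suff : Gamma Delta E `<=` G by apply; rewrite ext.
exact: (smallest_sub (conj GC Gd) WG).
Qed.

Lemma negated_justifications_lit x (S : set formula) :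
  negated_justifications (lit_default x) `&` S = set0 <-> ~ S (Neg (lit x)).
Proof.
split=> [e Sx|nS].
  have : set0 (Neg (lit x)) by rewrite -e; split=> //; exists (lit x); rewrite ?inE.
  by [].
by rewrite -subset0 => f [[b]]; rewrite inE => /eqP -> -> /nS.
Qed.

Lemma applied_lit x E : applied (lit_default x) E <-> ~ Cn E (lit (cpl x)).
Proof.
rewrite /applied negated_justifications_lit Cn_Neg_lit.
by split=> [[]|nE] //; split=> // v.
Qed.

(* An extension amounts to a choice of one literal of each conflicting pair. *)
Definition literal_choice (D W : seq (nat * bool)) (B : set (nat * bool)) : Prop :=
  [/\ consistent B, [set` W] `<=` B, B `<=` [set` W] `|` [set` D] &
      forall x, x \in D -> B x \/ B (cpl x)].

(** An unblocked default has its conclusion in [B], because [B] decides every literal with a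
    default. Conversely, a literal of [B] is a fact or has a default, unblocked by consistency. *)
Lemma literal_choice_extension D W B :
  literal_choice D W B -> extension (lit_theory D W) (Cn (lit @` B)).
Proof.
move=> [Bc WB BWD Bm]; rewrite /extension eqEsubset; split.
  apply: smallest_sub => [|_ /mapP[x xW ->]].
    split; first exact: CnK.
    move=> _ /mapP[x xD ->] _ /negated_justifications_lit.
    rewrite Cn_Neg_lit => nBx; apply: sub_Cn; apply: imageP.
    by case: (Bm x xD) => // Bx; case: nBx; apply: sub_Cn; apply: imageP.
  by apply: sub_Cn; apply: imageP; apply: WB.
move=> f Bf G [[GC Gd] WG]; rewrite -GC; apply: Cn_mono Bf => _ [x Bx <-].
case: (BWD x Bx) => [xW|xD]; first by apply: WG; apply: map_f.
apply: (Gd (lit_default x)); first exact: map_f.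
  by rewrite -GC => v.
apply/negated_justifications_lit; rewrite Cn_Neg_lit => /(Cn_lit Bc).
exact: Bc.
Qed.

(** [B] collects the facts and the conclusions of the defaults that [E] does not block. *)
Lemma extension_choice D W E : consistent [set` W] ->
  extension (lit_theory D W) E ->
  exists2 B, literal_choice D W B & E = Cn (lit @` B).
Proof.
move=> Wc ext; have EC := extension_Cn ext.
pose B := [set x | x \in W \/ x \in D /\ ~ E (Neg (lit x))].
have BE : lit @` B `<=` E.
  move=> _ [x [xW|[xD nE]] <-].
    by apply: (extension_facts ext); apply: map_f.
  apply: (extension_closed ext (d := lit_default x)); first exact: map_f.
    by rewrite -EC => v.
  exact/negated_justifications_lit.
have Bc : consistent B.
  (* Were [B] inconsistent, [E] would contain every formula and block every default, leaving only
     the consistent [W] in [B]. *)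
  apply: contrapT => nc; apply: (nc) => x Bx Bcx.
  have EN y : E (Neg (lit y)) by rewrite -EC; apply: not_consistent_Cn BE.
  case: Bx => [xW|[_ /(_ (EN _)) //]]; case: Bcx => [cxW|[_ /(_ (EN _)) //]].
  exact: (Wc x).
have EB : E = Cn (lit @` B).
  rewrite eqEsubset; split; last by rewrite -EC; apply: Cn_mono.
  rewrite -{1}ext; apply: smallest_sub => [|_ /mapP[x xW ->]]; last first.
    by apply: sub_Cn; apply: imageP; left.
  split=> [|_ /mapP[x xD ->] _ /negated_justifications_lit nE]; first exact: CnK.
  by apply: sub_Cn; apply: imageP; right.
exists B => //; split=> // [x xW|x [xW|[xD _]]|x xD]; [by left|by left|by right|].
case: (pselect (E (Neg (lit x)))) => [Ex|nEx]; last by left; right.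
by right; apply: Cn_lit Bc _; rewrite -Cn_Neg_lit -EB.
Qed.

Lemma applied_choice B x : consistent B ->
  applied (lit_default x) (Cn (lit @` B)) <-> ~ B (cpl x).
Proof.
move=> Bc; rewrite applied_lit CnK; split=> nB; last by move/(Cn_lit Bc).
by move=> Bx; apply: nB; apply: sub_Cn; apply: imageP.
Qed.

(** Supplies the rival extension that differs in one conflicting pair. *)
Lemma literal_choice_swap D W B x : literal_choice D W B -> x \in D -> cpl x \in D ->
  x \notin W -> cpl x \notin W ->
  literal_choice D W [set y | y = x \/ B y /\ y <> cpl x].
Proof.
move=> [Bc WB BWD Bm] xD cxD xW cxW; have xcx := @cpl_neq x.
split.
- move=> y [->|[By ycx]] [cyx|[Bcy cycx]] //.
  + by apply: xcx; rewrite cyx.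
  + by apply: ycx; rewrite -cyx cplK.
  + exact: (Bc y).
- move=> y yW; right; split; first exact: WB.
  by move=> yE; move: yW cxW; rewrite yE /= => ->.
- by move=> y [->|[/BWD]]; [right|].
- move=> y yD; case: (eqVneq y x) => [->|yx]; first by left; left.
  case: (eqVneq y (cpl x)) => [->|ycx]; first by right; left; rewrite cplK.
  case: (Bm y yD) => By; [left|right]; right; split=> //; first exact/eqP.
  by move/(can_inj cplK)/eqP; apply/negP.
Qed.

(** * The entailment test and its correctness *)

Definition pair_default (xy : (nat * bool) * (nat * bool)) :=
  (lit_default xy.1, lit_default xy.2).

(** Looking up the single pair in [P] suffices, since the listed relation is already transitive. *)
Definition lit_test (D W : seq (nat * bool))
    (P : seq ((nat * bool) * (nat * bool))) (x : nat * bool) : bool :=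
  (x \in W) ||
  [&& cpl x \notin W, x \in D & (cpl x \notin D) || ((x, cpl x) \in P)].

Definition entailment_test D W P (x : nat * bool) : bool :=
  has (fun y => cpl y \in W) W || lit_test D W P x.

Lemma consistentP W : consistent [set` W] <-> has (fun y => cpl y \in W) W = false.
Proof.
split=> [Wc|/hasPn/= Wn x /Wn /negP//].
by apply/hasPn => y yW; apply/negP; apply: Wc.
Qed.

Lemma mem_lit_default D W x : defaults (lit_theory D W) (lit_default x) <-> x \in D.
Proof. by rewrite /= mem_map //; apply: lit_default_inj. Qed.

Lemma mem_pair_default P x y :
  [set` map pair_default P] (lit_default x, lit_default y) <-> (x, y) \in P.
Proof.
rewrite /= (mem_map (f := pair_default) _ _ (x, y)) //.
move=> [a b] [c d] /[dup] /(congr1 fst)/lit_default_inj /= ->.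
by move/(congr1 snd)/lit_default_inj => /= ->.
Qed.

(** If [E] chose [cpl x], exchanging it for [x] would give an extension applying the default of [x];
    preference then forces [T] to put the default of [cpl x] first, against [P]. *)
Lemma entailment_test_sound D W P x E : entailment_test D W P x ->
  preferred (lit_theory D W) [set` map pair_default P] E -> E (lit x).
Proof.
move=> test [ext [T [[[_ _ Tasym] _] PT pref]]].
have WE : lit @` [set` W] `<=` E.
  by move=> _ [y yW <-]; apply: (extension_facts ext); apply: map_f.
case/orP: test => [Wi|].
  rewrite -(extension_Cn ext); apply: not_consistent_Cn WE.
  by move/consistentP; rewrite Wi.
case/orP=> [xW|/and3P[cxW xD xP]]; first by apply: WE; exists x.
case: (pselect (consistent [set` W])) => Wc; last first.
  by rewrite -(extension_Cn ext); apply: not_consistent_Cn WE.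
have [B Bch EB] := extension_choice Wc ext; have [Bc WB BWD Bm] := Bch.
rewrite {}EB in ext pref *; apply: contrapT => nx.
have Bcx : B (cpl x).
  by case: (Bm x xD) => // Bx; case: nx; apply: sub_Cn; apply: imageP.
have cxD : cpl x \in D by case: (BWD _ Bcx) => //= cx; rewrite cx in cxW.
have xW : x \notin W.
  by apply/negP => xW; apply: nx; apply: sub_Cn; apply: imageP; apply: WB.
rewrite cxD /= in xP.
have B'ch := literal_choice_swap Bch xD cxD xW cxW; set B' := mkset _ in B'ch.
have B'c : consistent B' by case: B'ch.
have Dx : defaults (lit_theory D W) (lit_default x) by exact/mem_lit_default.
case: (pref _ _ (literal_choice_extension B'ch) Dx) =>
    [|_ [/mapP[z zD ->] Tz [az naz]]].
  split; first by rewrite applied_choice // => -[/esym|[]//]; apply: cpl_neq.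
  by rewrite applied_choice // => /(_ Bcx).
(* The only literal of [B'] that may be missing from [B] is [x], so only the default of [cpl x] can
   become blocked. *)
move: az naz; rewrite !applied_choice // => nBz /contrapT -[zx|[/nBz//]].
have zE : z = cpl x by rewrite -zx cplK.
rewrite zE in Tz; apply: (Tasym _ _ Tz); apply: PT.
exact/mem_pair_default.
Qed.

(* The extension preferred by a total order [T] takes the [T]-first literal of
   each conflicting pair. *)
Definition first_choice (D W : seq (nat * bool)) (T : set (default * default)) :
    set (nat * bool) :=
  [set x | x \in W \/ [/\ x \in D, cpl x \notin W &
     cpl x \in D -> T (lit_default x, lit_default (cpl x))]].

Lemma first_choice_literal_choice D W T : consistent [set` W] ->
  strict_total_order (defaults (lit_theory D W)) T ->
  literal_choice D W (first_choice D W T).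
Proof.
move=> Wc [[_ _ Tasym] Ttot]; split.
- move=> x [xW|[xD cxW xT]] [cW|[cD]].
  + exact: (Wc x).
  + by rewrite cplK xW.
  + by rewrite cW in cxW.
  + move=> _; rewrite cplK => /(_ xD); apply: Tasym; exact: xT.
- by move=> x xW; left.
- by move=> x [xW|[xD _ _]]; [left|right].
- move=> x xD; case: (boolP (cpl x \in W)) => cxW; first by right; left.
  case: (boolP (x \in W)) => xW; first by left; left.
  case: (boolP (cpl x \in D)) => cxD; last first.
    by left; right; split=> // h; rewrite h in cxD.
  case: (Ttot (lit_default x) (lit_default (cpl x))).
  + exact/mem_lit_default.
  + exact/mem_lit_default.
  + by move/lit_default_inj; apply: cpl_neq.
  + by left; right.
  + by right; right; rewrite cplK.
Qed.

(** If the default of [x] applies in [E'] only, then [cpl x] is the first choice and is not a fact.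
    Its own default is [T]-earlier and is blocked in [E'], which contains [x]. *)
Lemma first_choice_preferred D W P T : consistent [set` W] ->
  strict_total_order (defaults (lit_theory D W)) T -> P `<=` T ->
  preferred (lit_theory D W) P (Cn (lit @` first_choice D W T)).
Proof.
move=> Wc Tord PT; have ch := first_choice_literal_choice Wc Tord.
have [Bc WB BWD Bm] := ch.
split; [exact: literal_choice_extension|exists T; split=> //].
move=> E' _ ext' /mapP[x xD ->] [].
have [B' [B'c WB' _ Bm'] ->] := extension_choice Wc ext'.
rewrite !applied_choice // => nB'x /contrapT Bcx.
have [cxW|[cxD _]] := Bcx; first by case: nB'x; apply: WB'.
rewrite cplK => /(_ xD) Tx.
exists (lit_default (cpl x)); split=> //; first exact/mem_lit_default.
have B'x : B' x by case: (Bm' x xD).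
split; rewrite applied_choice // cplK; last by apply.
by move=> Bx; apply: (Bc x Bx).
Qed.

Lemma entailment_test_complete D W P x :
  strict_partial_order (defaults (lit_theory D W)) [set` map pair_default P] ->
  (forall E, preferred (lit_theory D W) [set` map pair_default P] E -> E (lit x)) ->
  entailment_test D W P x.
Proof.
move=> Ppo all; rewrite /entailment_test /lit_test; apply: contrapT => /negP.
rewrite !negb_or => /and3P[Wc xW nx].
have {}Wc : consistent [set` W] by exact/consistentP/negbTE.
suff [T [Tord PT nT]] : exists T,
    [/\ strict_total_order (defaults (lit_theory D W)) T,
    [set` map pair_default P] `<=` T & ~ first_choice D W T x].
  apply: nT; apply: (Cn_lit _ (all _ (first_choice_preferred Wc Tord PT))).
  by case: (first_choice_literal_choice Wc Tord).
(* In the first case no order makes [x] a first choice; in the second the order decides. *)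
have {nx} [nx|[cxW xD cxD nP]] : ~ (cpl x \notin W /\ x \in D) \/
    [/\ cpl x \notin W, x \in D, cpl x \in D & (x, cpl x) \notin P].
  move: nx; case: (cpl x \notin W) => /=; last by left; case.
  case: (x \in D) => /=; last by left; case.
  by rewrite negb_or negbK => /andP[]; right.
  have [T Tord PT] := linear_extension Ppo.
  exists T; split=> // -[xW'|[xD cxW _]]; first by rewrite xW' in xW.
  by apply: nx.
(* [P] does not rank [x] over [cpl x], so the opposite ranking can be added before linearizing. *)
have [||||R [Rpo PR Rx]] :=
    @strict_partial_order_add _ _ _ (lit_default (cpl x)) (lit_default x) Ppo.
- exact/mem_lit_default.
- exact/mem_lit_default.
- by move/lit_default_inj/esym; apply: cpl_neq.
- by move/mem_pair_default; apply/negP.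
have [T Tord RT] := linear_extension Rpo.
exists T; split=> //; first exact: subset_trans PR RT.
case=> [xW'|[_ _ /(_ cxD) Tx]]; first by rewrite xW' in xW.
by case: Tord => [[_ _ Tasym] _]; apply: (Tasym _ _ Tx); apply: RT.
Qed.

(** * Scanning an encoded instance *)

Inductive part := Defaults | Facts | Priorities.

Definition part_code (t : part) : option bool :=
  match t with Defaults => None | Facts => Some false | Priorities => Some true end.

Definition part_decode (o : option bool) : part :=
  match o with None => Defaults | Some false => Facts | Some true => Priorities end.

Lemma part_codeK : cancel part_code part_decode.
Proof. by case. Qed.

HB.instance Definition _ := Finite.copy part (can_type part_codeK).

(* With [p] the variable looked for: [in_neg] tells whether the last symbol was a
   negation, [in_last] is the sign of the last literal if it is on [p], and
   [in_left] the same for the last literal before [SLess].  The three functions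
   hold the signs [b] such that the literal [(p, b)] is the conclusion of a
   default, is a fact, and is preferred to its complement, respectively. *)
Record inner_state := InnerState {
  in_part : part;
  in_neg : bool;
  in_left : option bool;
  in_last : option bool;
  in_defaults : {ffun bool -> bool};
  in_facts : {ffun bool -> bool};
  in_priorities : {ffun bool -> bool}
}.

Definition inner_code (x : inner_state) :=
  (in_part x, in_neg x, in_left x, in_last x, in_defaults x, in_facts x,
   in_priorities x).

Definition inner_decode (c : part * bool * option bool * option bool *
    {ffun bool -> bool} * {ffun bool -> bool} * {ffun bool -> bool}) :=
  let: (t, n, l, a, D, W, P) := c in InnerState t n l a D W P.

Lemma inner_codeK : cancel inner_code inner_decode.
Proof. by case. Qed.

HB.instance Definition _ := Finite.copy inner_state (can_type inner_codeK).

Definition record_sign (f : {ffun bool -> bool}) (o : option bool) :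
    {ffun bool -> bool} :=
  [ffun c => f c || (o == Some c)].

Definition record_pair (f : {ffun bool -> bool}) (l a : option bool) :
    {ffun bool -> bool} :=
  [ffun c => f c || (l == Some c) && (a == Some (~~ c))].

(** The last literal of an encoded default is its conclusion, so keeping one sign is enough. The
    query is read in the part [Priorities], but no semicolon follows it and it is never recorded. *)
Definition inner_step (x : inner_state) (s : symbol) (m : bool) : inner_state :=
  let: InnerState t n l a D W P := x in
  match s with
  | SNeg => InnerState t true l a D W P
  | SVar => InnerState t false l (if m then Some (~~ n) else None) D W P
  | SLess => InnerState t n a a D W P
  | SSemicolon =>
      match t with
      | Defaults => InnerState t n None None (record_sign D a) W P
      | Facts => InnerState t n None None D (record_sign W a) P
      | Priorities => InnerState t n None None D W (record_pair P l a)
      end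
  | SHash => InnerState (if t is Defaults then Facts else Priorities) n l a D W P
  | _ => x
  end.

Definition inner_start : inner_state :=
  InnerState Defaults false None None [ffun=> false] [ffun=> false] [ffun=> false].

(* The components of an outer state: whether two complementary facts have been
   found, whether the last symbol was a negation, and the result of the test for
   the last literal, provided that the facts are consistent. *)
Definition outer_leave (y : bool * bool * bool) (x : inner_state) :
    bool * bool * bool :=
  let: (i, n, _) := y in
  let: InnerState _ _ _ _ D W P := x in
  (i || W true && W false, false,
   W (~~ n) || [&& ~~ W n, D (~~ n) & ~~ D n || P (~~ n)]).

Definition test_scan : nested_scan :=
  @NestedScan (bool * bool * bool)%type inner_state (false, false, false)
    (fun y s => if s is SNeg then (y.1.1, true, y.2) else y)
    inner_start inner_step outer_leave (fun y => y.1.1 || y.2).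

(** Makes comparing digit strings the same as comparing variables; zero has the empty string. *)
Lemma encode_nat_inj : injective encode_nat.
Proof.
have pos_nil p : encode_pos p <> [::] by case: p.
have pos_inj : injective encode_pos.
  elim=> [p IH|p IH|] [q|q|] //= [].
  - by move/IH => ->.
  - by case: p {IH}.
  - by move/IH => ->.
  - by case: q.
move=> m n; rewrite /encode_nat => e; apply: (can_inj bin_of_natK).
case: (bin_of_nat m) (bin_of_nat n) e => [|p] [|q] //.
- by move/esym/pos_nil.
- by move/pos_nil.
- by move/pos_inj => ->.
Qed.

Lemma all_digit_encode_nat n : all is_digit (encode_nat n).
Proof. by rewrite /encode_nat; case: bin_of_nat => // p; elim: p. Qed.

(** Ensures that the digits of a variable do not run on into what follows. *)
Definition starts_nondigit (w : seq symbol) : bool :=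
  if w is s :: _ then ~~ is_digit s else true.

Lemma digits_cat u w : all is_digit u -> starts_nondigit w -> digits (u ++ w) = u.
Proof.
elim: u => [|s u IH] /=; first by case: w => //= s w _ /negPf ->.
by case/andP => -> uD wN; rewrite IH.
Qed.

(** * The inner scan of an encoded instance *)

Definition match_sign (p : nat) (x : nat * bool) : option bool :=
  if x.1 == p then Some x.2 else None.

Lemma match_signE p x b : (match_sign p x == Some b) = ((p, b) == x).
Proof.
case: x => q c; rewrite /match_sign xpair_eqE /= (eq_sym p).
by case: (q == p) => //; apply: eq_sym.
Qed.

Lemma inner_scan_digits ref x u w : all is_digit u ->
  @inner_scan test_scan ref x (u ++ w) = @inner_scan test_scan ref x w.
Proof.
elim: u => // s u IH /andP[sd uD]; rewrite -[RHS]IH //=.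
by case: x {IH}; case: s sd.
Qed.

Lemma inner_scan_lit p t l a D W P x w : starts_nondigit w ->
  @inner_scan test_scan (encode_nat p) (InnerState t false l a D W P)
    (encode_formula (lit x) ++ w) =
  @inner_scan test_scan (encode_nat p)
    (InnerState t false l (match_sign p x) D W P) w.
Proof.
move=> wN; case: x => q [] /=; rewrite digits_cat ?all_digit_encode_nat //;
  by rewrite inner_scan_digits ?all_digit_encode_nat // (inj_eq encode_nat_inj).
Qed.

Lemma inner_scan_default p t l a D W P x w : starts_nondigit w ->
  @inner_scan test_scan (encode_nat p) (InnerState t false l a D W P)
    (encode_default (lit_default x) ++ w) =
  @inner_scan test_scan (encode_nat p)
    (InnerState t false l (match_sign p x) D W P) w.
Proof.
move=> wN; rewrite /encode_default [prerequisite _]/= [justifications _]/=.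
rewrite [conclusion _]/= [flatten _]/= cats0 /= -!catA inner_scan_lit //=.
by rewrite inner_scan_lit.
Qed.

Lemma encode_list_cons (A : Type) (enc : A -> seq symbol) x s w :
  encode_list enc (x :: s) ++ w = enc x ++ SSemicolon :: (encode_list enc s ++ w).
Proof. by rewrite /encode_list /= -!catA. Qed.

Lemma inner_scan_defaults p D0 W P (D : seq (nat * bool)) w :
  @inner_scan test_scan (encode_nat p) (InnerState Defaults false None None D0 W P)
    (encode_list encode_default (map lit_default D) ++ w) =
  @inner_scan test_scan (encode_nat p) (InnerState Facts false None None
    [ffun b => D0 b || ((p, b) \in D)] W P) w.
Proof.
elim: D D0 => [|x D IH] D0.
  rewrite /=; do 2 f_equal.
  by apply/ffunP => b; rewrite ffunE orbF.
rewrite map_cons encode_list_cons inner_scan_default //= IH.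
do 2 f_equal; apply/ffunP => b; rewrite !ffunE -orbA inE.
by rewrite match_signE.
Qed.

Lemma inner_scan_facts p D W0 P (W : seq (nat * bool)) w :
  @inner_scan test_scan (encode_nat p) (InnerState Facts false None None D W0 P)
    (encode_list encode_formula (map lit W) ++ w) =
  @inner_scan test_scan (encode_nat p) (InnerState Priorities false None None
    D [ffun b => W0 b || ((p, b) \in W)] P) w.
Proof.
elim: W W0 => [|x W IH] W0.
  rewrite /=; do 2 f_equal.
  by apply/ffunP => b; rewrite ffunE orbF.
rewrite map_cons encode_list_cons inner_scan_lit //= IH.
do 2 f_equal; apply/ffunP => b; rewrite !ffunE -orbA inE.
by rewrite match_signE.
Qed.

Lemma encode_pair_default x y w : encode_pair (pair_default (x, y)) ++ w =
  encode_default (lit_default x) ++ SLess :: (encode_default (lit_default y) ++ w).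
Proof. by rewrite /encode_pair -catA. Qed.

Lemma inner_scan_less ref t n l a D W P w :
  @inner_scan test_scan ref (InnerState t n l a D W P) (SLess :: w) =
  @inner_scan test_scan ref (InnerState t n a a D W P) w.
Proof. by []. Qed.

Lemma inner_scan_priorities p D W P0 P w :
  @inner_scan test_scan (encode_nat p)
    (InnerState Priorities false None None D W P0)
    (encode_list encode_pair (map pair_default P) ++ w) =
  @inner_scan test_scan (encode_nat p) (InnerState Priorities false None None
    D W [ffun b => P0 b || (((p, b), cpl (p, b)) \in P)]) w.
Proof.
elim: P P0 => [|[x y] P IH] P0.
  rewrite /=; do 2 f_equal.
  by apply/ffunP => b; rewrite ffunE orbF.
rewrite map_cons encode_list_cons encode_pair_default inner_scan_default //.
rewrite inner_scan_less.
rewrite inner_scan_default //= IH.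
do 2 f_equal; apply/ffunP => b; rewrite !ffunE -orbA inE.
by rewrite !match_signE xpair_eqE.
Qed.

Definition clash (W : seq (nat * bool)) (x : nat * bool) : bool :=
  ((x.1, true) \in W) && ((x.1, false) \in W).

Definition lit_instance D W P x : instance :=
  Instance (map lit_default D) (map lit W) (map pair_default P) (lit x).

Lemma inner_scan_instance p D W P x :
  exists t n l a, @inner_scan test_scan (encode_nat p) inner_start
    (encode_instance (lit_instance D W P x)) =
  InnerState t n l a [ffun b => (p, b) \in D] [ffun b => (p, b) \in W]
    [ffun b => ((p, b), cpl (p, b)) \in P].
Proof.
rewrite /encode_instance /= inner_scan_defaults inner_scan_facts.
rewrite inner_scan_priorities -[encode_formula _]cats0 inner_scan_lit //=.
exists Priorities, false, None, (match_sign p x).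
by congr (InnerState _ _ _ _ _ _ _); apply/ffunP => b; rewrite !ffunE.
Qed.

(** * The outer scan of an encoded instance *)

Lemma outer_scan_digits input y u w : all is_digit u ->
  @outer_scan test_scan input y (u ++ w) = @outer_scan test_scan input y w.
Proof. by elim: u => //= s u IH /andP[sd uD]; rewrite -[RHS]IH //; case: s sd. Qed.

Lemma outer_scan_skip input y s w :
  (if s is SVar then false else if s is SNeg then false else true) ->
  @outer_scan test_scan input y (s :: w) = @outer_scan test_scan input y w.
Proof. by case: s. Qed.

Lemma outer_scan_lit D W P q i c x w : starts_nondigit w ->
  @outer_scan test_scan (encode_instance (lit_instance D W P q)) (i, false, c)
    (encode_formula (lit x) ++ w) =
  @outer_scan test_scan (encode_instance (lit_instance D W P q))
    (i || clash W x, false, lit_test D W P x) w.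
Proof.
move=> wN; case: x => p b.
have [t [n [l [a e]]]] := inner_scan_instance p D W P q.
case: b => /=; rewrite digits_cat ?all_digit_encode_nat // e /= !ffunE;
  by rewrite outer_scan_digits ?all_digit_encode_nat.
Qed.

Lemma outer_scan_default D W P q i c x w : starts_nondigit w ->
  @outer_scan test_scan (encode_instance (lit_instance D W P q)) (i, false, c)
    (encode_default (lit_default x) ++ w) =
  @outer_scan test_scan (encode_instance (lit_instance D W P q))
    (i || clash W x, false, lit_test D W P x) w.
Proof.
move=> wN; rewrite /encode_default [prerequisite _]/= [justifications _]/=.
rewrite [conclusion _]/= [flatten _]/= cats0 -!catA.
rewrite [encode_formula Top]/= !cat_cons !cat0s !outer_scan_skip //.
rewrite -catA outer_scan_lit // !cat_cons.
by rewrite !outer_scan_skip // outer_scan_lit // -orbA orbb.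
Qed.

(** Only the clash flag accumulates; the test result is overwritten at each variable, hence
    existential. *)
Lemma outer_scan_list D W P q (A B : Type) (enc : A -> seq symbol) (g : B -> A)
    (f : B -> bool) s i c w :
  (forall x j d v, starts_nondigit v -> exists d',
     @outer_scan test_scan (encode_instance (lit_instance D W P q)) (j, false, d)
       (enc (g x) ++ v) =
     @outer_scan test_scan (encode_instance (lit_instance D W P q))
       (j || f x, false, d') v) ->
  exists c', @outer_scan test_scan (encode_instance (lit_instance D W P q))
    (i, false, c) (encode_list enc (map g s) ++ w) =
  @outer_scan test_scan (encode_instance (lit_instance D W P q))
    (i || has f s, false, c') w.
Proof.
move=> encP; elim: s i c => [|x s IH] i c; first by exists c; rewrite /= orbF.
rewrite map_cons encode_list_cons.
have [d ->] := encP x i c (SSemicolon :: (encode_list enc (map g s) ++ w)) isT.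
have [c' e] := IH (i || f x) d; exists c'.
by rewrite outer_scan_skip // e /= orbA.
Qed.

Lemma has_clash W : has (clash W) W = has (fun y => cpl y \in W) W.
Proof.
apply: eq_in_has => -[p []] pW; rewrite /clash /cpl /= pW //=.
by rewrite andbT.
Qed.

Lemma clash_has W x : clash W x -> has (clash W) W.
Proof. by move=> xc; apply/hasP; exists (x.1, true) => //; case/andP: xc. Qed.

(** The query is the last literal scanned, so its test result is the one that survives. *)
Lemma test_scan_decides D W P x :
  ns_decides test_scan (encode_instance (lit_instance D W P x)) =
  entailment_test D W P x.
Proof.
rewrite /ns_decides.
pose w3 := encode_formula (lit x) ++ [::].
pose w2 := encode_list encode_pair (map pair_default P) ++ w3.
pose w1 := encode_list encode_formula (map lit W) ++ w2.
have input : encode_instance (lit_instance D W P x) =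
    encode_list encode_default (map lit_default D) ++ w1.
  by rewrite /w1 /w2 /w3 cats0.
rewrite [X in outer_scan _ _ X]input [ns_start _]/=.
have [|c1 ->] := @outer_scan_list D W P x _ _ encode_default lit_default (clash W) D
    false false w1.
  by move=> y j d v vN; exists (lit_test D W P y); rewrite outer_scan_default.
have [|c2 ->] := @outer_scan_list D W P x _ _ encode_formula lit (clash W) W
    (false || has (clash W) D) c1 w2.
  by move=> y j d v vN; exists (lit_test D W P y); rewrite outer_scan_lit.
have [|c3 ->] := @outer_scan_list D W P x _ _ encode_pair pair_default
    (fun yz => clash W yz.1 || clash W yz.2) P
    (false || has (clash W) D || has (clash W) W) c2 w3.
  move=> [y z] j d v vN; exists (lit_test D W P z); rewrite encode_pair_default.
  by rewrite outer_scan_default // outer_scan_skip // outer_scan_default // orbA.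
rewrite outer_scan_lit // /entailment_test -has_clash /=; congr (_ || _).
(* A clash seen at any literal is a clash within [W], so the literals of [D] and [P] do not change
   the flag. *)
case: (boolP (has (clash W) W)) => [_|/negP nW]; first by rewrite orbT.
have nc y : clash W y = false by apply/negP => /clash_has.
rewrite nc !orbF; apply/negbTE; rewrite negb_or.
by apply/andP; split; apply/hasPn => y _; rewrite !nc.
Qed.

Lemma seq_preimage (A B : eqType) (f : A -> B) (s : seq B) :
  (forall y, y \in s -> exists x, y = f x) -> exists t, s = map f t.
Proof.
elim: s => [|y s IH] sP; first by exists [::].
have [x ->] := sP y (mem_head _ _).
have [z zs|t ->] := IH; first by apply: sP; rewrite inE zs orbT.
by exists (x :: t).
Qed.

Lemma literal_lit f : literal f -> exists x, f = lit x.
Proof. by move=> [p [->|->]]; [exists (p, true)|exists (p, false)]. Qed.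

Lemma valid_lit_instance I : literal_theory (inst_theory I) ->
  [set` inst_priority I] `<=`
    defaults (inst_theory I) `*` defaults (inst_theory I) ->
  literal (inst_query I) -> exists D W P x, I = lit_instance D W P x.
Proof.
case: I => D W P f [/= Wl Dl] PD /literal_lit[x ->].
have Dd d : d \in D -> exists y, d = lit_default y.
  by move=> /Dl[_ /literal_lit[y ->] ->]; exists y.
have [D' eD] := seq_preimage Dd.
have [W' eW] := seq_preimage (fun w wW => literal_lit (Wl w wW)).
have [[d e] /PD[/Dd[y /= ->] /Dd[z /= ->]]|P' eP] :=
  @seq_preimage _ _ pair_default P.
  by exists (y, z).
by exists D', W', P', x; rewrite eD eW eP.
Qed.

Theorem theorem5p23 :
  polytime_testable encode_instance
    [set I : instance |
      [/\ literal_theory (inst_theory I),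
          strict_partial_order (defaults (inst_theory I))
            [set` inst_priority I] &
          literal (inst_query I)]]
    [set I : instance |
      preferred_entails (inst_theory I) [set` inst_priority I] (inst_query I)].
Proof.
apply: (@polytime_of_nested_scan test_scan) => I [Il Ipo Iq].
have [PD _ _] := Ipo; have [D [W [P [x e]]]] := valid_lit_instance Il PD Iq.
rewrite e in Ipo *; rewrite test_scan_decides.
split=> [test E|]; first exact: (entailment_test_sound test).
exact: entailment_test_complete.
Qed.
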